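(* For each integer $i\ge 0$, the ring $K[X]$ is $\mathrm{Inc}(\mathbb{N})^i$-noetherian, that is, every $\mathrm{Inc}(\mathbb{N})^i$-invariant ideal of $K[X]$ is generated by finitely many $\mathrm{Inc}(\mathbb{N})^i$-orbits: there are finitely many polynomials $f_1,\ldots,f_m \in K[X]$ such that the ideal is generated by $\{\pi(f_l) \mid 1\le l\le m,\ \pi\in\mathrm{Inc}(\mathbb{N})^i\}$.
   Context: $K$ is an arbitrary field, $c \ge 1$ is a fixed integer, and $K[X]$ is the polynomial ring over $K$ in the variables $X=\{x_{j,k} \mid 1 \le j \le c,\ k \in \mathbb{N}\}$, where $\mathbb{N}=\{1,2,\ldots\}$. $\mathrm{Inc}(\mathbb{N})$ is the monoid of strictly increasing functions $\pi:\mathbb{N}\to\mathbb{N}$, and for an integer $i\ge 0$, $\mathrm{Inc}(\mathbb{N})^i=\{\pi\in\mathrm{Inc}(\mathbb{N}) \mid \pi(j)=j \text{ for all } j\le i\}$. It acts on $K[X]$ by $K$-algebra homomorphisms via $\pi\cdot x_{j,k}=x_{j,\pi(k)}$. An ideal $I\subseteq K[X]$ is $\mathrm{Inc}(\mathbb{N})^i$-invariant if $\pi(f)\in I$ for all $f\in I$, $\pi\in\mathrm{Inc}(\mathbb{N})^i$. The $\mathrm{Inc}(\mathbb{N})^i$-orbit of $f\in K[X]$ is $\{\pi(f) \mid \pi\in\mathrm{Inc}(\mathbb{N})^i\}$. *)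

(* Defs.v *)
From HB Require Import structures.
From mathcomp Require Import all_boot all_order all_algebra.
From mathcomp Require Import finmap.
From mathcomp Require Import monalg.

Set Implicit Arguments.
Unset Strict Implicit.
Unset Printing Implicit Defensive.

Import GRing.Theory.
Local Open Scope ring_scope.

(* Both indices are shifted to start at 0: the variable (j, k) stands for
   x_{j+1,k+1}, and pi : nat -> nat for the function k+1 |-> pi k + 1. *)
Notation xindex c := ('I_c * nat)%type.

Notation "{ 'xpoly' K [ c ] }" := {malg K[{cmonom (xindex c)}]}
  (at level 0, K, c at level 2, format "{ 'xpoly'  K [ c ] }") : type_scope.

Definition xvar (K : fieldType) (c : nat) (j : 'I_c) (k : nat) : {xpoly K[c]} :=
  << 1 *g ucm (j, k) >>.

(* Under the shift, fixing 1, ..., i becomes fixing 0, ..., i-1. *)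
Definition Inc (i : nat) (pi : nat -> nat) : Prop :=
  {homo pi : k l / (k < l)%N} /\ (forall k, (k < i)%N -> pi k = k).

Definition act_monom (K : fieldType) (c : nat) (pi : nat -> nat)
    (m : {cmonom (xindex c)}) : {xpoly K[c]} :=
  \prod_(v <- finsupp m) xvar K v.1 (pi v.2) ^+ m v.
Arguments act_monom {K c} pi m.

Definition act (K : fieldType) (c : nat) (pi : nat -> nat)
    (f : {xpoly K[c]}) : {xpoly K[c]} :=
  mmap (fun a : K => a%:MP) (act_monom pi) f.

Lemma act_monom_mmorphism (K : fieldType) (c : nat) (pi : nat -> nat) :
  mmorphism (act_monom pi : {cmonom (xindex c)} -> {xpoly K[c]}).
Proof.
have ext (m : {cmonom (xindex c)}) (D : {fset xindex c}) :
    (finsupp m `<=` D)%fset ->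
    act_monom pi m = \prod_(v <- D) xvar K v.1 (pi v.2) ^+ m v.
  move=> le; rewrite /act_monom; apply: big_fset_incl => // v _ /fsfun_dflt ->.
  by rewrite expr0.
split=> [m1 m2|]; last by rewrite /act_monom mdom1 big_seq_fset0.
rewrite (ext m1 (finsupp m1 `|` finsupp m2)%fset) ?fsubsetUl //.
rewrite (ext m2 (finsupp m1 `|` finsupp m2)%fset) ?fsubsetUr //.
rewrite (ext _ (finsupp m1 `|` finsupp m2)%fset) ?mdomD //.
by rewrite -big_split /=; apply: eq_bigr => v _; rewrite cmM exprD.
Qed.

HB.instance Definition _ (K : fieldType) (c : nat) (pi : nat -> nat) :=
  isMultiplicative.Build {cmonom (xindex c)} {xpoly K[c]} (act_monom pi)
    (act_monom_mmorphism K c pi).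

(* act pi is the K-algebra endomorphism with x_{j,k} |-> x_{j,pi k}. *)
HB.instance Definition _ (K : fieldType) (c : nat) (pi : nat -> nat) :=
  GRing.RMorphism.copy (@act K c pi)
    (mmap (fun a : K => a%:MP) (act_monom pi : _ -> {xpoly K[c]})).

Fact act_scalable (K : fieldType) (c : nat) (pi : nat -> nat) :
  scalable (@act K c pi).
Proof. by move=> a f; rewrite /act mmapZ mul_malgC. Qed.

HB.instance Definition _ (K : fieldType) (c : nat) (pi : nat -> nat) :=
  GRing.isScalable.Build K {xpoly K[c]} {xpoly K[c]} *:%R (@act K c pi)
    (@act_scalable K c pi).

Lemma act_xvar (K : fieldType) (c : nat) (pi : nat -> nat) (j : 'I_c)
    (k : nat) : act pi (xvar K j k) = xvar K j (pi k).
Proof.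
by rewrite /act mmapU mul1r /act_monom mdomU big_seq_fset1 cmUU expr1.
Qed.

(* MathComp's idealr structure is not used here: it requires ideals to be
   proper and given by boolean predicates. *)
Definition is_ideal (R : comNzRingType) (I : R -> Prop) : Prop :=
  [/\ I 0, (forall f g, I f -> I g -> I (f + g))
     & (forall h f, I f -> I (h * f))].

Definition ideal_gen (R : comNzRingType) (S : R -> Prop) (f : R) : Prop :=
  forall J : R -> Prop, is_ideal J -> (forall g, S g -> J g) -> J f.

Definition Inc_invariant (K : fieldType) (c i : nat) (I : {xpoly K[c]} -> Prop)
    : Prop :=
  forall pi f, Inc i pi -> I f -> I (act pi f).

Definition Inc_orbit (K : fieldType) (c i : nat) (f g : {xpoly K[c]}) : Prop :=
  exists2 pi, Inc i pi & g = act pi f.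

(* Main.v *)
Require Import Defs.
From mathcomp Require Import all_boot all_order all_algebra.
From mathcomp Require Import finmap monalg.
From mathcomp Require Import boolp.
From mathcomp Require Import zify.

Set Implicit Arguments.
Unset Strict Implicit.

Import GRing.Theory.
Local Open Scope ring_scope.

(** The argument is the one behind Groebner bases, with monomial division
replaced by division up to renaming of the variables: say that [m1] divides
[m2] when some [pi] in Inc^i turns [m1] into a divisor of [m2].

This relation is a well-quasi-order ([Inc_divides_wqo]): every infinite
sequence of monomials has an earlier term dividing a later one.  Indeed, read a
monomial as the word whose letter at place [k] is the column of exponents of
the [x_(j,k)].  Columns compared entrywise form a well-quasi-order by Dickson's
lemma, so words compared by embedding do too by [higman], and the embedding of
places is precisely the map [pi] that is needed.  The condition that [pi] fixes
the places below [i] is enforced by making the truncated place part of the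
letter.

The lexicographic order [mlt], in which the variables with larger place weigh
more, is respected by multiplication and by every strictly increasing [pi].
It has minimal elements because a divisor is never [mlt]-larger
([Inc_divides_not_mlt]), so an infinite descent would contradict the
well-quasi-order.

Suppose now that an invariant ideal [I] is not generated by finitely many
orbits.  Choose [u 0], [u 1], ... in [I], each outside the ideal generated by
the orbits of the previous ones and with the [mlt]-least possible leading
monomial.  The leading monomial of some [u k] divides that of a later [u l]
through some [pi], so subtracting a monomial multiple of [pi (u k)] cancels the
leading term of [u l] ([lead_cancel]).  The difference is still in [I] and
outside the ideal generated so far, yet has a smaller leading monomial:
a contradiction.

The same device of a greedily minimal sequence ([minimal_choice]) is used
three times: here, for Nash-Williams' minimal bad sequence in the proof of
[higman], and to extract nondecreasing subsequences of natural numbers. *)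

(** * Greedily minimal sequences *)

(** Well-foundedness, stated through minimal elements, which is the form that
the choices below consume. *)
Definition has_minima (M : Type) (lt : M -> M -> Prop) : Prop :=
  forall P : M -> Prop, (exists x, P x) ->
    exists2 x, P x & forall y, lt y x -> ~ P y.

Lemma ltn_has_minima : has_minima (fun m n : nat => (m < n)%N).
Proof.
move=> P [n Pn].
have exP : exists n, `[< P n >] by exists n; apply/asboolP.
case: (ex_minnP exP) => m /asboolP Pm minm; exists m => // k ltkm /asboolP Pk.
by have := minm _ Pk; rewrite leqNgt ltkm.
Qed.

(** [P s x] reads: [x] may follow the initial segment [s].  If every admissible
step can be continued, then steps can be chosen one after the other, each with
least [mu] among those that the previous choices allow. *)
Lemma minimal_choice (T M : Type) (lt : M -> M -> Prop) (mu : T -> M)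
    (P : seq T -> T -> Prop) :
    has_minima lt -> (exists x, P [::] x) ->
    (forall s x, P s x -> exists y, P (rcons s x) y) ->
  exists u : nat -> T, forall n,
    P (mkseq u n) (u n) /\
    forall y, lt (mu y) (mu (u n)) -> ~ P (mkseq u n) y.
Proof.
move=> minlt P0 PS; have [x0 _] := P0.
have /choice[pick pickP] (s : seq T) : exists x, (exists y, P s y) ->
    P s x /\ forall y, lt (mu y) (mu x) -> ~ P s y.
  have [exP|nexP] := pselect (exists y, P s y); last by exists x0.
  have [|_ [x Px <-] minx] := minlt (fun m => exists2 x, P s x & mu x = m).
    by have [y Py] := exP; exists (mu y), y.
  by exists x => _; split=> // y /minx ltyx Py; apply: ltyx; exists y.
(* The whole history is iterated, since each step depends on all of it. *)
pose st n := iter n (fun s => rcons s (pick s)) [::].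
pose u n := pick (st n).
have stE n : mkseq u n = st n by elim: n => // n IHn; rewrite mkseqS IHn.
exists u => n; rewrite stE; apply: (pickP).
elim: n => [//|n IHn]; exact: (PS _ _ (proj1 (pickP _ IHn))).
Qed.

Arguments minimal_choice {T M lt} mu P.

(** * Perfect orders and Higman's lemma *)

(** The well-quasi-order property in its subsequence form, which unlike the
form with just one increasing pair is visibly stable under conjunction: pass
to a subsequence twice. *)
Definition perfect (T : Type) (R : T -> T -> Prop) : Prop :=
  forall u : nat -> T, exists2 g : nat -> nat,
    {homo g : k l / (k < l)%N} & forall k l, (k < l)%N -> R (u (g k)) (u (g l)).

(** Let each [g n] be an index beyond all earlier ones at which [h \o u] is
least.  Every later index was also available when [g k] was chosen, so the
chosen values do not decrease. *)
Lemma perfect_leq (T : Type) (h : T -> nat) :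
  perfect (fun x y => (h x <= h y)%N).
Proof.
move=> u.
pose P s n := all (fun m => m < n)%N s.
have [||g gP] := minimal_choice (h \o u) P ltn_has_minima.
- by exists 0%N.
- move=> s x Psx; exists x.+1; rewrite /P all_rcons ltnSn /=.
  by apply: sub_all Psx => m /ltnW.
have ltg : {homo g : k l / (k < l)%N}.
  move=> k l ltkl; have [/allP Pl _] := gP l.
  by apply: Pl; apply: map_f; rewrite mem_iota.
exists g => // k l ltkl; rewrite leqNgt; apply/negP => lt_u.
have [_ /(_ (g l) lt_u)] := gP k; apply.
apply/allP => _ /mapP[m + ->]; rewrite mem_iota /= add0n => ltmk.
exact/ltg/(ltn_trans ltmk).
Qed.

Lemma perfect_and (T : Type) (R S : T -> T -> Prop) :
  perfect R -> perfect S -> perfect (fun x y => R x y /\ S x y).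
Proof.
move=> pR pS u; have [g ltg Rg] := pR u; have [h lth Sh] := pS (u \o g).
exists (g \o h) => [k l /lth/ltg //|k l ltkl]; split; last exact: Sh.
exact/Rg/lth.
Qed.

(** Dickson's lemma, for a finite family of arbitrary perfect relations. *)
Lemma perfect_forall (T : Type) (I : finType) (R : I -> T -> T -> Prop) :
  (forall i, perfect (R i)) -> perfect (fun x y => forall i, R i x y).
Proof.
move=> pR; suff pRs (s : seq I) :
    perfect (fun x y => forall i, i \in s -> R i x y).
  move=> u; have [g ltg Rg] := pRs (enum I) u; exists g => // k l ltkl i.
  by apply: Rg; rewrite ?mem_enum.
elim: s => [|i s IHs] u; first by exists id.
have [g ltg Rg] := perfect_and (pR i) IHs u; exists g => // k l ltkl j.
by have [Ri Rs] := Rg _ _ ltkl; rewrite in_cons => /orP[/eqP->|/Rs].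
Qed.

Section Higman.

Variables (T : Type) (x0 : T) (R : T -> T -> Prop).

(** The embedding is given by a map on all of [nat], not only on the places of
[s], because such a map is what acts on the variables. *)
Definition embeds (s t : seq T) : Prop :=
  exists2 pi : nat -> nat, {homo pi : k l / (k < l)%N} &
    forall k, (k < size s)%N ->
      (pi k < size t)%N /\ R (nth x0 s k) (nth x0 t (pi k)).

Lemma embeds_nil t : embeds [::] t.
Proof. by exists id. Qed.

Lemma embeds_behead s t : embeds s (behead t) -> embeds s t.
Proof.
case=> pi ltpi Rpi; exists (fun k => (pi k).+1) => [k l /ltpi //|k ltks].
have [lt_pi Rk] := Rpi k ltks; rewrite -nth_behead; split=> //.
by move: lt_pi; rewrite size_behead ltn_predRL.
Qed.

Lemma embeds_cons x y s t : R x y -> embeds s t -> embeds (x :: s) (y :: t).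
Proof.
move=> Rxy [pi ltpi Rpi].
exists (fun k => if k is k'.+1 then (pi k').+1 else 0%N)
  => [[|k] [|l] //|[|k]] //=.
  by rewrite !ltnS => /ltpi.
exact: Rpi.
Qed.

(** Nash-Williams' argument.  Take a bad sequence [w] whose terms are, one after
the other, as short as possible.  Its words are nonempty; choose a subsequence
[g] along which the first letters increase.  Then [w 0], ..., [w (g 0).-1]
followed by the tails of [w (g 0)], [w (g 1)], ... is again bad, since an
embedding between two tails extends to the words; but it is shorter at [g 0]. *)
Theorem higman (u : nat -> seq T) :
  perfect R -> exists k l, (k < l)%N /\ embeds (u k) (u l).
Proof.
move=> pR; apply: contrapT => nogood.
pose bad v := forall k l, (k < l)%N -> ~ embeds (v k) (v l).
pose P s x := exists2 v, bad v & mkseq v (size s).+1 = rcons s x.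
have [||w wP] := minimal_choice size P ltn_has_minima.
- by exists (u 0%N), u => // k l ltkl ukl; apply: nogood; exists k, l.
- move=> s x [v badv defs]; exists (v (size s).+1), v => //.
  by rewrite mkseqS size_rcons defs.
have badw : bad w.
  move=> k l ltkl; have [[v badv +] _] := wP l.
  rewrite size_mkseq -mkseqS => defv; have := badv _ _ ltkl.
  have vE n : (n < l.+1)%N -> v n = w n.
    by move=> ltn; rewrite -(nth_mkseq [::] v ltn) defv nth_mkseq.
  by rewrite !vE // ltnW.
have w_cons n : w n = head x0 (w n) :: behead (w n).
  have := badw n n.+1 (ltnSn n); case: (w n) => // /(_ (embeds_nil _)) [].
have [g ltg Rg] := pR (fun n => head x0 (w n)).
have leg n : (g 0 <= g n)%N by case: n => // n; apply/ltnW/ltg.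
have [_ /(_ (behead (w (g 0%N))))] := wP (g 0%N).
case; first by rewrite size_behead {2}w_cons /= size_behead.
exists (fun n => if (n < g 0)%N then w n else behead (w (g (n - g 0))%N)).
  move=> k l ltkl; case: (ltnP l (g 0%N)) => [ltl|lel].
    by rewrite (ltn_trans ltkl ltl); apply: badw.
  case: (ltnP k (g 0%N)) => [ltk|lek].
    move=> /embeds_behead; apply: badw; exact: leq_trans ltk (leg _).
  have ltkl' : (k - g 0 < l - g 0)%N by rewrite ltn_sub2r // (leq_ltn_trans lek).
  move=> /(embeds_cons (Rg _ _ ltkl')); rewrite -!w_cons; exact/badw/ltg.
rewrite size_mkseq mkseqS ltnn subnn; congr rcons.
by apply/eq_in_map => n; rewrite mem_iota /= add0n => ->.
Qed.

End Higman.

(** * Divisibility of monomials up to increasing renaming *)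

Section MonomialDivisibility.

Variable c : nat.
Local Notation monom := {cmonom (xindex c)}.
Implicit Types (m : monom) (v w : xindex c).

Definition shift (pi : nat -> nat) v : xindex c := (v.1, pi v.2).

Definition Inc_divides (i : nat) m1 m2 : Prop :=
  exists2 pi, Inc i pi & forall v, (m1 v <= m2 (shift pi v))%N.

(** The letter of a monomial [m] at place [k] is the pair [(m, k)], standing for
the column of exponents [m (_, k)].  The word covers the support of [m] and has
length at least [i], so that an embedding has a say on all places below [i]. *)
Definition columns (i : nat) m : seq (monom * nat) :=
  [seq (m, k) | k <- iota 0 (i + \max_(v <- finsupp m) v.2.+1)].

(** The last two conditions say that the two places agree after truncation at
[i]; as inequalities between nat-valued functions they fall under
[perfect_leq]. *)
Definition column_le (i : nat) (a b : monom * nat) : Prop :=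
  (forall j : 'I_c, (a.1 (j, a.2) <= b.1 (j, b.2))%N) /\
  ((minn a.2 i <= minn b.2 i)%N /\ (i - a.2 <= i - b.2)%N).

Lemma perfect_column_le i : perfect (column_le i).
Proof.
do 2?[apply: perfect_and]; last exact: perfect_leq.
  apply: perfect_forall => j.
  exact: (perfect_leq (fun a : monom * nat => a.1 (j, a.2))).
exact: (perfect_leq (fun a : monom * nat => minn a.2 i)).
Qed.

Lemma embeds_columns i m1 m2 :
    embeds (mone, 0%N) (column_le i) (columns i m1) (columns i m2) ->
  Inc_divides i m1 m2.
Proof.
have nthc m k : (k < size (columns i m))%N ->
    nth (mone, 0%N) (columns i m) k = (m, k).
  rewrite size_map size_iota => ltk.
  by rewrite (nth_map 0%N) ?size_iota ?nth_iota.
case=> pi ltpi Rpi; exists pi.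
  split=> // k ltki; have ltk : (k < size (columns i m1))%N.
    by rewrite size_map size_iota ltn_addr.
  have [lt_pik] := Rpi k ltk; rewrite !nthc //.
  (* As k < i, truncation at i keeps k, which forces pi k = k. *)
  by case=> _ [/= le_min le_sub]; lia.
move=> [j k]; rewrite /shift /=.
have [ltk|] := ltnP k (size (columns i m1)).
  by have [lt_pik] := Rpi k ltk; rewrite !nthc // => -[].
rewrite size_map size_iota; case: mdomP => // in_m1 lek.
have ltk : (k < \max_(v <- finsupp m1) v.2.+1)%N.
  exact: (leq_bigmax_seq _ in_m1).
by have := leq_trans ltk (leq_trans (leq_addl i _) lek); rewrite ltnn.
Qed.

Theorem Inc_divides_wqo i (u : nat -> monom) :
  exists k l, (k < l)%N /\ Inc_divides i (u k) (u l).
Proof.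
have [k [l [ltkl /embeds_columns dvd]]] :=
  higman (mone, 0%N) (columns i \o u) (perfect_column_le i).
by exists k, l.
Qed.

(** * The lexicographic order on monomials *)

(** The position of a variable when the variables are listed column by column:
a strictly increasing [pi] preserves this listing. *)
Definition vrank v : nat := (v.2 * c + v.1)%N.

Lemma ltn_vrank v w :
  (vrank v < vrank w)%N = (v.2 < w.2)%N || (v.2 == w.2) && (v.1 < w.1)%N.
Proof.
have lt_block v' w' : (v'.2 < w'.2)%N -> (vrank v' < vrank w')%N.
  move=> lt; rewrite /vrank (@leq_trans (v'.2.+1 * c)) //.
    by rewrite mulSn addnC ltn_add2r.
  by rewrite (leq_trans _ (leq_addr _ _)) // leq_mul2r lt orbT.
case: (ltngtP v.2 w.2) => [/lt_block //|/lt_block lt|e] /=.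
  by rewrite ltnNge ltnW.
by rewrite /vrank e ltn_add2l.
Qed.

Lemma vrank_inj : injective vrank.
Proof.
move=> v w e; have := ltn_vrank v w; have := ltn_vrank w v.
rewrite e ltnn; case: v w {e} => [j k] [j' k'] /=.
by case: ltngtP => //= ->; case: ltngtP => // /val_inj ->.
Qed.

Lemma ltn_vrank_shift pi v w : {homo pi : k l / (k < l)%N} ->
  (vrank (shift pi v) < vrank (shift pi w))%N = (vrank v < vrank w)%N.
Proof.
move=> /leq_mono le_pi.
by rewrite !ltn_vrank /= (leqW_mono le_pi) !eqn_leq !le_pi.
Qed.

Lemma shift_inj pi : {homo pi : k l / (k < l)%N} -> injective (shift pi).
Proof.
move=> ltpi v w e; apply: vrank_inj.
case: (ltngtP (vrank v) (vrank w)) => //.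
  by rewrite -(ltn_vrank_shift _ _ ltpi) e ltnn.
by rewrite -(ltn_vrank_shift _ _ ltpi) e ltnn.
Qed.

(** Lexicographic comparison with the variables of larger rank weighing more.
Finiteness of the supports is what makes it total: two distinct monomials have
a last variable where they differ. *)
Definition mlt m1 m2 : Prop :=
  exists2 v, (m1 v < m2 v)%N & forall w, (vrank v < vrank w)%N -> m1 w = m2 w.

Lemma mlt_irr m : ~ mlt m m.
Proof. by case=> v; rewrite ltnn. Qed.

Lemma mlt_trans m1 m2 m3 : mlt m1 m2 -> mlt m2 m3 -> mlt m1 m3.
Proof.
move=> [v ltv eqv] [w ltw eqw].
case: (ltngtP (vrank v) (vrank w)) => [lt|lt|/vrank_inj e].
- by exists w => [|x ltx]; [rewrite eqv | rewrite eqv ?eqw // (ltn_trans lt)].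
- by exists v => [|x ltx]; [rewrite -eqw | rewrite eqv ?eqw // (ltn_trans lt)].
- exists v => [|x ltx]; first by rewrite (ltn_trans ltv) // e.
  by rewrite eqv ?eqw -?e.
Qed.

Lemma mlt_total m1 m2 : m1 <> m2 -> mlt m1 m2 \/ mlt m2 m1.
Proof.
move=> ne; pose S := (finsupp m1 `|` finsupp m2)%fset.
pose P n := has (fun v => (vrank v == n) && (m1 v != m2 v)) S.
have PS v : m1 v != m2 v -> P (vrank v).
  move=> nev; apply/hasP; exists v; last by rewrite eqxx.
  rewrite in_fsetU -!cmE_neq0; apply: contraR nev.
  by rewrite negb_or !negbK => /andP[/eqP-> /eqP->].
have exP : exists n, P n.
  apply: contrapT => nP; apply: ne; apply/eqP/cmP => v; apply/eqP.
  by apply/negPn/negP => /PS Pv; apply: nP; exists (vrank v).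
have ubP n : P n -> (n <= \max_(v <- S) vrank v)%N.
  case/hasP => v vS /andP[/eqP<- _]; exact: (leq_bigmax_seq _ vS).
case: (ex_maxnP exP ubP) => n /hasP[v _ /andP[/eqP<- nev]] maxn.
have eqw w : (vrank v < vrank w)%N -> m1 w = m2 w.
  move=> lt; apply/eqP/negPn/negP => /PS/maxn; by rewrite leqNgt lt.
move: nev; rewrite neq_ltn => /orP[lt|lt]; first by left; exists v.
by right; exists v => // w /eqw.
Qed.

Lemma mlt_mul m m1 m2 : mlt m1 m2 -> mlt (mmul m m1) (mmul m m2).
Proof.
by case=> v lt e; exists v => [|w /e]; rewrite !cmM ?ltn_add2l // => ->.
Qed.

(** Suppose the largest variable where the exponents differ is [(j, k)], and
that [m1] has the larger exponent there.  Division forces [pi k <> k], hence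
[k < pi k], and the exponent of [m1] at [(j, k)] is at most that of [m2] at
[(j, pi k)], where [m1] and [m2] agree.  Repeating this, [m1] has a positive
exponent at [(j, k)], [(j, pi k)], [(j, pi (pi k))], ..., against the
finiteness of its support. *)
Lemma Inc_divides_not_mlt i m1 m2 : Inc_divides i m1 m2 -> ~ mlt m2 m1.
Proof.
case=> pi [ltpi _] le12 [[j k] lt21 eq21].
have le_m n : (k + n <= iter n pi k)%N /\ (iter n pi k < iter n.+1 pi k)%N /\
    (m1 (j, k) <= m1 (j, iter n pi k))%N.
  elim: n => [|n [len [ltn le1]]].
    split; [by rewrite addn0 | split=> //].
    have lek l : (l <= pi l)%N.
      by elim: l => // l IHl; apply: leq_ltn_trans IHl (ltpi _ _ _).
    rewrite ltn_neqAle lek andbT; apply: contraL (le12 (j, k)) => /eqP e.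
    by rewrite /shift /= -[pi k]e -ltnNge.
  split; first by rewrite addnS; apply: leq_ltn_trans len ltn.
  split; first exact: ltpi.
  apply: leq_trans le1 (leq_trans (le12 _) _); rewrite /shift /= eq21 //.
  rewrite ltn_vrank /= (leq_ltn_trans _ ltn) //.
  exact: leq_trans (leq_addr _ _) len.
pose n := \max_(v <- finsupp m1) v.2.+1.
have [len [_ le1]] := le_m n.
have in_m1 : (j, iter n pi k) \in finsupp m1.
  by rewrite -cmE_neq0 -lt0n (leq_trans _ le1) // (leq_ltn_trans _ lt21).
have : (iter n pi k < n)%N by exact: (leq_bigmax_seq _ in_m1).
by rewrite ltnNge (leq_trans (leq_addl _ _) len).
Qed.

(** An infinite descent would contain two terms, the earlier dividing the
later; the order therefore inherits its minima from the well-quasi-order. *)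
Lemma mlt_has_minima : has_minima mlt.
Proof.
move=> P [m0 Pm0]; apply: contrapT => nomin.
have /choice[next nextP] m : exists m', P m -> P m' /\ mlt m' m.
  apply: contrapT => nex; apply: nomin; exists m.
    by apply: contrapT => nPm; apply: nex; exists m.
  by move=> m' lt Pm'; apply: nex; exists m'.
pose u n := iter n next m0.
have Pu n : P (u n) by elim: n => // n /nextP[].
have ltu : {homo u : k l / (k < l)%N >-> mlt l k}.
  apply: homo_ltn => [m1 m2 m3 lt12 lt23|n]; last exact: (nextP _ (Pu n)).2.
  exact: mlt_trans lt23 lt12.
have [k [l [ltkl /Inc_divides_not_mlt]]] := Inc_divides_wqo 0 u.
by apply; apply: ltu.
Qed.

End MonomialDivisibility.

(** * Cancelling leading terms *)

Section Reduction.

Variables (K : fieldType) (c : nat).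
Local Notation monom := {cmonom (xindex c)}.
Implicit Types (m : monom) (v w : xindex c) (f g : {xpoly K[c]}).

(** The monomial with which [act_monom pi m], a product of polynomials,
coincides. *)
Definition rename (pi : nat -> nat) m : monom :=
  \big[mmul/mone]_(v <- finsupp m) iter (m v) (mmul (ucm (shift pi v))) mone.

Lemma mulmalgUU (a b : K) m1 m2 :
  << a *g m1 >> * << b *g m2 >> = << a * b *g mmul m1 m2 >> :> {xpoly K[c]}.
Proof. by rewrite malgM_def fgmulUU. Qed.

Lemma mkmalg1M m1 m2 :
  << mmul m1 m2 >> = << m1 >> * << m2 >> :> {xpoly K[c]}.
Proof. by rewrite mulmalgUU mul1r. Qed.

Lemma act_monomE pi m : act_monom pi m = << rename pi m >> :> {xpoly K[c]}.
Proof.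
rewrite /rename (big_morph _ mkmalg1M (erefl _)); apply: eq_bigr => v _.
elim: (m v) => [|n IHn]; first by rewrite expr0.
by rewrite exprS IHn iterS mkmalg1M.
Qed.

Lemma renameE pi m w :
  rename pi m w = (\sum_(v <- finsupp m | shift pi v == w) m v)%N.
Proof.
rewrite /rename (big_morph (fun m' : monom => m' w) (cmM w) (cm1 w)).
rewrite [RHS]big_mkcond; apply: eq_bigr => v _.
elim: (m v) => [|n IHn] /=; first by rewrite cm1; case: eqP.
by rewrite cmM cmU IHn; case: eqP.
Qed.

Lemma rename_shift pi m v : {homo pi : k l / (k < l)%N} ->
  rename pi m (shift pi v) = m v.
Proof.
move=> ltpi; rewrite renameE; have sh_eq := inj_eq (shift_inj ltpi).
case: mdomP => [vm|vNm]; last first.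
  rewrite big_seq_cond big_pred0 // => w; rewrite sh_eq andbC.
  by case: eqP => // ->; apply/negbTE.
rewrite big_mkcond (bigD1_seq v) ?fset_uniq //= eqxx big1 ?addn0 // => w.
by rewrite sh_eq => /negbTE->.
Qed.

Lemma rename_out pi m w : (forall v, shift pi v <> w) -> rename pi m w = 0%N.
Proof. by move=> out; rewrite renameE big_pred0 // => v; apply/eqP/out. Qed.

Lemma mlt_rename pi m1 m2 : {homo pi : k l / (k < l)%N} ->
  mlt m1 m2 -> mlt (rename pi m1) (rename pi m2).
Proof.
move=> ltpi [v lt e]; exists (shift pi v); first by rewrite !rename_shift.
move=> w; have [[x <-]|out] := pselect (exists x, shift pi x = w).
  by rewrite ltn_vrank_shift // !rename_shift //; apply: e.
by rewrite !rename_out // => x ex; apply: out; exists x.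
Qed.

Lemma Inc_divides_rename i m1 m2 : Inc_divides i m1 m2 ->
  exists2 pi, Inc i pi & exists q, m2 = mmul q (rename pi m1).
Proof.
case=> pi Inc_pi le12; have [ltpi _] := Inc_pi.
exists pi => //; exists (divcm m2 (rename pi m1)).
apply/eqP/cmP => w; rewrite cmM divcmE subnK //.
have [[v <-]|out] := pselect (exists v, shift pi v = w).
  by rewrite rename_shift.
by rewrite rename_out // => v ev; apply: out; exists v.
Qed.

Definition is_lead f m : Prop :=
  m \in msupp f /\ forall m', m' \in msupp f -> m' <> m -> mlt m' m.

Lemma is_lead_exists f : f <> 0 -> exists m, is_lead f m.
Proof.
move=> nz; suff seq_max (s : seq monom) : s <> [::] ->
    exists2 m, m \in s & forall m', m' \in s -> m' <> m -> mlt m' m.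
  have [|m mf maxm] := seq_max (msupp f); last by exists m.
  move=> e; apply: nz; apply/eqP; rewrite -msupp_eq0.
  apply/eqP/fsetP => m; rewrite in_fset0.
  by rewrite -[_ \in _]/(m \in (msupp f : seq _)) e.
elim: s => // m s IHs _.
have [->|/eqP/IHs[m' m's maxm']] := eqVneq s [::].
  by exists m => [|m']; rewrite mem_seq1 // => /eqP.
have [e|/eqP/mlt_total[lt|lt]] := eqVneq m m'.
- by exists m' => [|x]; rewrite in_cons ?m's ?orbT // e => /orP[/eqP|/maxm'].
- exists m' => [|x]; first by rewrite in_cons m's orbT.
  by rewrite in_cons => /orP[/eqP->|/maxm'].
- exists m => [|x]; first exact: mem_head.
  rewrite in_cons => /orP[/eqP //|xs] _.
  have [->//|/eqP ne] := eqVneq x m'.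
  by apply: mlt_trans lt; apply: maxm'.
Qed.

Lemma actE pi g :
  act pi g = \sum_(m <- msupp g) << g@_m *g rename pi m >>.
Proof.
rewrite /act mmapE; apply: eq_bigr => m _.
by rewrite act_monomE mulmalgUU mul1m mulr1.
Qed.

Lemma mcoeff_mul_act (a : K) (q : monom) pi g (w : monom) :
  (<< a *g q >> * act pi g)@_w =
  \sum_(m <- msupp g) (a * g@_m) *+ (mmul q (rename pi m) == w).
Proof.
rewrite actE mulr_sumr raddf_sum; apply: eq_bigr => m _.
by rewrite mulmalgUU; apply: mcoeffU.
Qed.

(** The map [m |-> q * rename pi m] is strictly increasing for [mlt] and sends
the leading monomial of [g] to that of [f].  Hence the subtracted polynomial
has the same leading term as [f], and all that remains is smaller. *)
Lemma lead_cancel pi (q : monom) f g mf mg : {homo pi : k l / (k < l)%N} ->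
    is_lead f mf -> is_lead g mg -> mf = mmul q (rename pi mg) ->
  forall w : monom,
    w \in msupp (f - << f@_mf / g@_mg *g q >> * act pi g) -> mlt w mf.
Proof.
move=> ltpi [mfin maxf] [mgin maxg] emf w.
pose phi m := mmul q (rename pi m).
have lt_phi m : m \in msupp g -> m <> mg -> mlt (phi m) mf.
  by move=> mg_in ne; rewrite emf; apply/mlt_mul/mlt_rename/maxg.
rewrite -mcoeff_neq0 mcoeffB mcoeff_mul_act => nz.
have [ew|/eqP new] := eqVneq w mf.
  case/eqP: nz; rewrite (bigD1_seq mg) ?fset_uniq //= -emf ew eqxx.
  rewrite big1_seq => [|m /andP[ne min]].
    by rewrite addr0 divfK ?subrr // mcoeff_neq0.
  case: eqP => // e; case: (@mlt_irr c mf).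
  by rewrite -{1}e; apply: lt_phi => //; apply/eqP.
have [wf|] := boolP (w \in msupp f); first exact: maxf.
move=> /mcoeff_outdom fw; rewrite fw sub0r oppr_eq0 in nz.
apply: contrapT => nlt; case/eqP: nz; rewrite big1_seq // => m /= min.
case: eqP => // e; have [em|/eqP ne] := eqVneq m mg.
  by case: new; rewrite -e em.
by case: nlt; rewrite -e; apply: lt_phi.
Qed.

End Reduction.

(** * Noetherianity up to increasing maps *)

Lemma ideal_gen_ideal (R : comNzRingType) (S : R -> Prop) :
  is_ideal (ideal_gen S).
Proof.
split=> [J [] //|f g Sf Sg J idJ SJ|h f Sf J idJ SJ]; have [_ JD JM] := idJ.
- by apply: JD; [apply: Sf|apply: Sg].
- by apply: JM; apply: Sf.
Qed.

Theorem corollary3p6 (K : fieldType) (c : nat) (i : nat) (hc : (0 < c)%N)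
    (I : {xpoly K[c]} -> Prop) (hI : is_ideal I) (hinv : Inc_invariant i I) :
  exists fs : seq {xpoly K[c]},
    forall f : {xpoly K[c]},
      I f <-> ideal_gen (fun g => exists2 h, h \in fs & Inc_orbit i h g) f.
Proof.
apply: contrapT => nofs.
have [I0 ID IM] := hI.
pose gen (fs : seq {xpoly K[c]}) :=
  ideal_gen (fun g => exists2 h, h \in fs & Inc_orbit i h g).
have [|lm lmP] := choice (P := fun f m => f <> 0 -> @is_lead K c f m).
  move=> f; have [->|/eqP nz] := eqVneq f 0; first by exists mone.
  by have [m mP] := is_lead_exists nz; exists m.
have gen_ideal fs : is_ideal (gen fs) by apply: ideal_gen_ideal.
pose P fs f := (forall h, h \in fs -> I h) /\ (I f /\ ~ gen fs f).
have ex_next fs : (forall h, h \in fs -> I h) -> exists f, P fs f.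
  move=> fsI; apply: contrapT => nof; apply: nofs; exists fs => f; split.
    by move=> If; apply: contrapT => ngen; apply: nof; exists f.
  by apply=> // g [h /fsI Ih [pi Inc_pi ->]]; apply: hinv.
have [||u uP] := minimal_choice lm P (@mlt_has_minima c).
- exact: ex_next.
- move=> fs f [fsI [If _]]; apply: ex_next => h.
  by rewrite mem_rcons in_cons => /orP[/eqP->|/fsI].
have u_neq0 n : u n <> 0.
  have [[_ [_ ngen]] _] := uP n => e; apply: ngen; rewrite e.
  by have [] := gen_ideal (mkseq u n).
have [k [l [ltkl /Inc_divides_rename[pi Inc_pi [q elm]]]]] :=
  Inc_divides_wqo i (lm \o u).
have [[fsI [Iul ngen]] min_ul] := uP l.
have [_ [Iuk _]] := (uP k).1.
have [ltpi _] := Inc_pi.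
have := lead_cancel ltpi (lmP _ (u_neq0 l)) (lmP _ (u_neq0 k)) elm.
(* p * act pi (u k) has the leading term of u l. *)
set p := << _ *g _ >> => lt_h.
have [gen0 genD genM] := gen_ideal (mkseq u l).
have gen_act : gen (mkseq u l) (p * act pi (u k)).
  apply: genM => J _; apply; exists (u k); last by exists pi.
  by apply: map_f; rewrite mem_iota.
have ngen_h : ~ gen (mkseq u l) (u l - p * act pi (u k)).
  move=> gen_h; apply: ngen.
  by rewrite -(subrK (p * act pi (u k)) (u l)); apply: genD.
apply: (min_ul (u l - p * act pi (u k))).
  apply: lt_h; have [] // := lmP (u l - p * act pi (u k)).
  by move=> e; apply: ngen_h; rewrite e.
split=> //; split=> //; apply: ID => //; rewrite -mulNr; apply: IM.
exact: hinv.
Qed.
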